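(* Let $D$ be a non-empty subset of $\{(g,r)\in\mathbb{N}^2\mid g+1\le r\le 2g\}$. Assume that a group $\Gamma$ is a member of the class $\mathcal{C}_{\mathrm{Surf}_D}$. Then there exist a group quotient $Q$ of $\Gamma$ and a quotient map $\sigma\colon\Gamma\twoheadrightarrow Q$ such that the pair $$(G,N)=\left(\mathbb{Z}\wr_{\rho_Q}\Gamma,\ \bigoplus_Q\mathbb{Z}\right),$$ where $\rho_Q\colon\Gamma\curvearrowright Q$ is the composition of $\sigma$ and the $Q$-action on $Q$ by left multiplication, satisfies the following: for every $(g,r)\in D$ there exists $x_{(g,r)}\in[G,N]$ such that $$\left\lceil\frac r2\right\rceil\le\mathrm{cl}_G(x_{(g,r)})\le g\quad\text{and}\quad\mathrm{cl}_{G,N}(x_{(g,r)})=r.$$ In particular, $\mathrm{cl}_G$ and $\mathrm{cl}_{G,N}$ do not coincide on $[G,N]$ for this pair $(G,N)$, which fits in the split short exact sequence $1\to N\to G\to\Gamma\to1$. If for a fixed real number $C\in[1,2)$ $$\sup_{(g,r)\in D}(r-Cg)=\infty$$ holds, then $$\sup_{x\in[G,N]}\left(\mathrm{cl}_{G,N}(x)-C\cdot\mathrm{cl}_G(x)\right)=\infty$$ for the pair $(G,N)$ above.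
   Context: $\mathbb{N}=\{1,2,3,\ldots\}$, and $\Sigma_g$ is the closed connected orientable surface of genus $g$. For an action $\rho\colon\Gamma\curvearrowright X$ on a set and a group $H$, the permutational wreath product is $H\wr_\rho\Gamma=\left(\bigoplus_XH\right)\rtimes\Gamma$, where $\Gamma$ acts on $\bigoplus_XH$ by shifts via $\rho$. For a group $G$ and a normal subgroup $N$, a mixed commutator is an element $[g,x]=gxg^{-1}x^{-1}$ with $g\in G$, $x\in N$; $[G,N]$ is the subgroup generated by mixed commutators, and for $x\in[G,N]$, $\mathrm{cl}_{G,N}(x)$ is the smallest integer $n\ge0$ such that $x$ is a product of $n$ mixed commutators. $\mathrm{cl}_G=\mathrm{cl}_{G,G}$ is the ordinary commutator length on $[G,G]$. The rank of a group is $\mathrm{rk}(\Lambda)=\inf\{\#S\mid\Lambda=\langle S\rangle\}$; for a subgroup $P\leqslant Q$, the intermediate rank is $\mathrm{int}\text{-}\mathrm{rk}^Q(P)=\inf\{\mathrm{rk}(\Theta)\mid P\leqslant\Theta\leqslant Q\}$. A $\pi_1(\Sigma_g)$-triple for a group $\Gamma$ is a triple $(\phi,Q,\sigma)$ of a homomorphism $\phi\colon\pi_1(\Sigma_g)\to\Gamma$ (not necessarily injective), a group quotient $Q$ of $\Gamma$, and a quotient map (surjective homomorphism) $\sigma\colon\Gamma\to Q$ such that $(\sigma\circ\phi)(\pi_1(\Sigma_g))$ is abelian. For non-empty $D\subseteq\{(g,r)\in\mathbb{N}^2\mid g+1\le r\le2g\}$, $\mathcal{C}_{\mathrm{Surf}_D}$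 is the class of all groups $\Gamma$ such that there exist a group quotient $Q$ of $\Gamma$ and a quotient map $\sigma\colon\Gamma\twoheadrightarrow Q$ such that for every $(g,r)\in D$ there exists $\phi_{(g,r)}\colon\pi_1(\Sigma_g)\to\Gamma$ for which $(\phi_{(g,r)},Q,\sigma)$ is a $\pi_1(\Sigma_g)$-triple for $\Gamma$ with $\mathrm{int}\text{-}\mathrm{rk}^Q(P_{(g,r)})=r$, where $P_{(g,r)}=(\sigma\circ\phi_{(g,r)})(\pi_1(\Sigma_g))$. *)

(* Defs.v *)
From HB Require Import structures.
From mathcomp Require Import all_boot all_algebra finmap.
From mathcomp Require Import all_classical all_reals ereal.

Set Implicit Arguments.
Unset Strict Implicit.
Unset Printing Implicit Defensive.

Local Open Scope classical_set_scope.
Local Open Scope group_scope.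

(* Infima of sets of (extended) natural numbers; +oo stands for the infimum of
   the empty set. [nat_min A] is only meaningful for nonempty [A]. *)
Definition nat_min (A : set nat) : nat :=
  xget 0%N [set n | A n /\ forall m, A m -> (n <= m)%N].

Definition enat_inf (A : set (\bar nat)) : \bar nat :=
  if `[< exists n : nat, A n%:E%E >] then (nat_min [set n | A n%:E%E])%:E%E
  else +oo%E.

Definition enat_card (T : choiceType) (S : set T) : \bar nat :=
  if `[< finite_set S >] then (#|` fset_set S|%fset)%:E%E else +oo%E.

Section Subgroups.
Variable G : groupType.
Implicit Types (S H N P : set G) (x : G).

Definition is_subgroup H : Prop :=
  [/\ H 1, forall x y, H x -> H y -> H (x * y) & forall x, H x -> H x^-1].

Definition gen S : set G := smallest is_subgroup S.

Definition is_abelian H : Prop := forall x y, H x -> H y -> x * y = y * x.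

Definition rank H : \bar nat := enat_inf [set enat_card S | S in [set S | gen S = H]].

Definition int_rank P : \bar nat :=
  enat_inf [set rank H | H in [set H | is_subgroup H /\ P `<=` H]].

(* MathComp's [~ g, x] is g^-1 x^-1 g x, hence the explicit formula. *)
Definition mixed_commutators N : set G :=
  [set c | exists g x, N x /\ c = g * x * g^-1 * x^-1].

Definition comm_subgroup N : set G := gen (mixed_commutators N).

(* cl_{G,N}, only meaningful for N normal and x in [G,N]; the ordinary
   commutator length cl_G is [cl setT]. *)
Definition cl N x : nat :=
  nat_min [set n | exists c : 'I_n -> G,
    (forall i, mixed_commutators N (c i)) /\ x = \prod_(i < n) c i].

End Subgroups.

Definition split_exact (K G L : groupType)
    (i : {multiplicative K -> G}) (p : {multiplicative G -> L}) : Prop :=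
  [/\ injective i, range i = p @^-1` [set 1], range p = setT
    & exists s : {multiplicative L -> G}, cancel s p].

Section Presentation.
Variables (X : choiceType) (rels : set (seq (X * bool))).

(* The letter (x, false) stands for x, and (x, true) for its inverse. *)
Definition word : Type := seq (X * bool).
HB.instance Definition _ := Choice.on word.

Definition inv_word (w : word) : word := rev [seq (l.1, ~~ l.2) | l <- w].

Inductive word_equiv : word -> word -> Prop :=
| WRefl u : word_equiv u u
| WSym u v : word_equiv u v -> word_equiv v u
| WTrans u v w : word_equiv u v -> word_equiv v w -> word_equiv u w
| WCat u u' v v' : word_equiv u u' -> word_equiv v v' ->
    word_equiv (u ++ v) (u' ++ v')
| WInv x b : word_equiv [:: (x, b); (x, ~~ b)] [::]
| WRel r : rels r -> word_equiv r [::].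

Definition word_eqv : rel word := fun u v => `[< word_equiv u v >].

Lemma word_eqv_refl : reflexive word_eqv.
Proof. by move=> u; apply/asboolP; exact: WRefl. Qed.

Lemma word_eqv_sym : symmetric word_eqv.
Proof. by move=> u v; apply/asboolP/asboolP; exact: WSym. Qed.

Lemma word_eqv_trans : transitive word_eqv.
Proof. by move=> v u w /asboolP uv /asboolP vw; apply/asboolP; exact: WTrans uv vw. Qed.

Canonical word_eqv_equiv := EquivRel word_eqv word_eqv_refl word_eqv_sym word_eqv_trans.

Local Open Scope quotient_scope.

Definition presented : Type := {eq_quot word_eqv_equiv}.
HB.instance Definition _ := Choice.on presented.
HB.instance Definition _ := EqQuotient.on presented.

Definition pres_class (w : word) : presented := \pi_presented w.

Lemma pres_classP (u v : word) : pres_class u = pres_class v <-> word_equiv u v.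
Proof.
split=> [/eqmodP/asboolP //|uv]; by apply/eqmodP/asboolP.
Qed.

Lemma pres_repr (x : presented) : pres_class (repr x) = x.
Proof. exact: reprK. Qed.

Lemma repr_pres (w : word) : word_equiv (repr (pres_class w)) w.
Proof. by apply/pres_classP; rewrite pres_repr. Qed.

Lemma inv_word_cat (u v : word) : inv_word (u ++ v) = inv_word v ++ inv_word u.
Proof. by rewrite /inv_word map_cat rev_cat. Qed.

Lemma inv_wordK : involutive inv_word.
Proof.
move=> w; rewrite /inv_word map_rev revK -map_comp -[RHS]map_id.
by apply: eq_map => -[x b] /=; rewrite negbK.
Qed.

Lemma word_invr (w : word) : word_equiv (w ++ inv_word w) [::].
Proof.
elim: w => [|[x b] w IH]; first exact: WRefl.
rewrite -cat1s inv_word_cat -catA (catA w).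
apply: (WTrans (v := [:: (x, b)] ++ ([::] ++ inv_word [:: (x, b)]))).
  by apply: WCat; [exact: WRefl|apply: WCat => //; exact: WRefl].
exact: WInv.
Qed.

Lemma word_invl (w : word) : word_equiv (inv_word w ++ w) [::].
Proof. by rewrite -{2}(inv_wordK w); exact: word_invr. Qed.

Lemma word_equiv_inv (u v : word) :
  word_equiv u v -> word_equiv (inv_word u) (inv_word v).
Proof.
move=> uv; have h1 : word_equiv (inv_word u ++ v ++ inv_word v) (inv_word u).
  rewrite -[X in word_equiv _ X]cats0.
  by apply: WCat; [exact: WRefl|exact: word_invr].
apply: (WTrans (WSym h1)); rewrite catA -[X in word_equiv _ X]cat0s.
apply: WCat; last exact: WRefl.
apply: WTrans (word_invl u); apply: WCat; [exact: WRefl|exact: WSym].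
Qed.

Definition pres_one : presented := pres_class [::].
Definition pres_mul (x y : presented) : presented := pres_class (repr x ++ repr y).
Definition pres_inv (x : presented) : presented := pres_class (inv_word (repr x)).

Lemma pres_mulE (u v : word) :
  pres_mul (pres_class u) (pres_class v) = pres_class (u ++ v).
Proof. by apply/pres_classP; apply: WCat; exact: repr_pres. Qed.

Lemma pres_invE (u : word) : pres_inv (pres_class u) = pres_class (inv_word u).
Proof. by apply/pres_classP; apply: word_equiv_inv; exact: repr_pres. Qed.

Lemma pres_mulA : associative pres_mul.
Proof.
move=> x y z; rewrite -(pres_repr x) -(pres_repr y) -(pres_repr z).
by rewrite !pres_mulE catA.
Qed.

Lemma pres_mul1 : left_id pres_one pres_mul.
Proof. by move=> x; rewrite -(pres_repr x) pres_mulE. Qed.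

Lemma pres_mulr1 : right_id pres_one pres_mul.
Proof. by move=> x; rewrite -(pres_repr x) pres_mulE cats0. Qed.

Lemma pres_mulV : left_inverse pres_one pres_inv pres_mul.
Proof.
move=> x; rewrite -(pres_repr x) pres_invE pres_mulE.
by apply/pres_classP; exact: word_invl.
Qed.

Lemma pres_mulrV : right_inverse pres_one pres_inv pres_mul.
Proof.
move=> x; rewrite -(pres_repr x) pres_invE pres_mulE.
by apply/pres_classP; exact: word_invr.
Qed.

HB.instance Definition _ := isGroup.Build presented
  pres_mulA pres_mul1 pres_mulr1 pres_mulV pres_mulrV.

End Presentation.

(* The generators of pi_1(Sigma_g) are a_i = (i, false) and b_i = (i, true);
   the single relator is [a_1, b_1] ... [a_g, b_g]. *)
Definition surface_relator (g : nat) : seq ('I_g * bool * bool) :=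
  flatten [seq [:: (i, false, false); (i, true, false);
                   (i, false, true); (i, true, true)] | i <- enum 'I_g].

Definition surface_group (g : nat) : groupType :=
  presented [set surface_relator g].

Section DirectSum.
Variables (X : choiceType) (H : groupType).

Definition dsum : Type := {fsfun X -> H with 1}.
HB.instance Definition _ := Choice.on dsum.

Definition dsum_fun (f : dsum) : X -> H := fun_of_fsfun f.
Local Coercion dsum_fun : dsum >-> Funclass.

Lemma dsumP (f f' : dsum) : f =1 f' -> f = f'.
Proof. by move/fsfunP. Qed.

Lemma dsum_dflt (f : dsum) x : x \notin finsupp f -> f x = 1.
Proof. exact: fsfun_dflt. Qed.

Definition dsum_one : dsum := [fsfun].
Definition dsum_mul (f f' : dsum) : dsum :=
  [fsfun x in (finsupp f `|` finsupp f')%fset => f x * f' x].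
Definition dsum_inv (f : dsum) : dsum := [fsfun x in finsupp f => (f x)^-1].

Lemma dsum_oneE x : dsum_one x = 1.
Proof. by rewrite /dsum_fun fsfun0E. Qed.

Lemma dsum_mulE (f f' : dsum) x : dsum_mul f f' x = f x * f' x.
Proof.
rewrite {1}/dsum_fun fsfun_fun in_fsetU.
by case: ifPn => // /norP[/dsum_dflt-> /dsum_dflt->]; rewrite mulg1.
Qed.

Lemma dsum_invE (f : dsum) x : dsum_inv f x = (f x)^-1.
Proof.
by rewrite {1}/dsum_fun fsfun_fun; case: ifPn => // /dsum_dflt->; rewrite invg1.
Qed.

Lemma dsum_mulA : associative dsum_mul.
Proof. by move=> f f' f''; apply: dsumP => x; rewrite !dsum_mulE mulgA. Qed.

Lemma dsum_mul1 : left_id dsum_one dsum_mul.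
Proof. by move=> f; apply: dsumP => x; rewrite dsum_mulE dsum_oneE mul1g. Qed.

Lemma dsum_mulr1 : right_id dsum_one dsum_mul.
Proof. by move=> f; apply: dsumP => x; rewrite dsum_mulE dsum_oneE mulg1. Qed.

Lemma dsum_mulV : left_inverse dsum_one dsum_inv dsum_mul.
Proof.
by move=> f; apply: dsumP => x; rewrite dsum_mulE dsum_invE dsum_oneE mulVg.
Qed.

Lemma dsum_mulrV : right_inverse dsum_one dsum_inv dsum_mul.
Proof.
by move=> f; apply: dsumP => x; rewrite dsum_mulE dsum_invE dsum_oneE mulgV.
Qed.

HB.instance Definition _ := isGroup.Build dsum
  dsum_mulA dsum_mul1 dsum_mulr1 dsum_mulV dsum_mulrV.

Lemma dsum1E x : (1 : dsum) x = 1.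
Proof. exact: dsum_oneE. Qed.

Lemma dsumME (f f' : dsum) x : (f * f' : dsum) x = f x * f' x.
Proof. exact: dsum_mulE. Qed.

End DirectSum.

Coercion dsum_fun : dsum >-> Funclass.

Record group_action (Gamma : groupType) (X : Type) := GroupAction {
  act :> Gamma -> X -> X;
  act1 : forall x, act 1 x = x;
  actM : forall a b x, act (a * b) x = act a (act b x) }.

(* The parameter rho does not occur in the carrier; it determines the group
   law declared below. *)
Record wreath (Gamma H : groupType) (X : choiceType)
    (rho : group_action Gamma X) : Type :=
  Wreath { wr_base : dsum X H; wr_top : Gamma }.

Arguments wreath {Gamma} H {X} rho.
Arguments Wreath {Gamma H X rho} wr_base wr_top.
Arguments wr_base {Gamma H X rho} w : rename.
Arguments wr_top {Gamma H X rho} w : rename.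

Section Wreath.
Variables (Gamma H : groupType) (X : choiceType) (rho : group_action Gamma X).

Definition shift (a : Gamma) (f : dsum X H) : dsum X H :=
  [fsfun x in [fset rho a y | y in finsupp f]%fset => f (rho a^-1 x)].

Lemma shiftE a f x : shift a f x = f (rho a^-1 x).
Proof.
rewrite {1}/dsum_fun fsfun_fun; case: ifPn => // /negP xNf.
rewrite dsum_dflt//; apply/negP => xf; apply: xNf; apply/imfsetP.
by exists (rho a^-1 x) => //; rewrite -actM mulgV act1.
Qed.

Lemma shift1 f : shift 1 f = f.
Proof. by apply: dsumP => x; rewrite shiftE invg1 act1. Qed.

Lemma shiftM a b f : shift (a * b) f = shift a (shift b f).
Proof. by apply: dsumP => x; rewrite !shiftE invgM actM. Qed.

Lemma shift_mul a f f' : shift a (f * f') = shift a f * shift a f'.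
Proof. by apply: dsumP => x; rewrite shiftE !dsumME !shiftE. Qed.

Lemma shift_one a : shift a 1 = 1.
Proof. by apply: dsumP => x; rewrite shiftE !dsum1E. Qed.

Definition wreath_pair (w : wreath H rho) := (wr_base w, wr_top w).
Definition pair_wreath (p : dsum X H * Gamma) : wreath H rho := Wreath p.1 p.2.
Lemma wreath_pairK : cancel wreath_pair pair_wreath. Proof. by case. Qed.
HB.instance Definition _ := Choice.copy (wreath H rho) (can_type wreath_pairK).

Definition wr_one : wreath H rho := Wreath 1 1.
Definition wr_mul (v w : wreath H rho) : wreath H rho :=
  Wreath (wr_base v * shift (wr_top v) (wr_base w)) (wr_top v * wr_top w).
Definition wr_inv (w : wreath H rho) : wreath H rho :=
  Wreath (shift (wr_top w)^-1 (wr_base w)^-1) (wr_top w)^-1.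

Lemma wr_mulA : associative wr_mul.
Proof.
by move=> u v w; rewrite /wr_mul /= shift_mul shiftM !mulgA.
Qed.

Lemma wr_mul1 : left_id wr_one wr_mul.
Proof. by case=> f a; rewrite /wr_mul /= shift1 !mul1g. Qed.

Lemma wr_mulr1 : right_id wr_one wr_mul.
Proof. by case=> f a; rewrite /wr_mul /= shift_one !mulg1. Qed.

Lemma wr_mulV : left_inverse wr_one wr_inv wr_mul.
Proof. by case=> f a; rewrite /wr_mul /= -shift_mul !mulVg shift_one. Qed.

Lemma wr_mulrV : right_inverse wr_one wr_inv wr_mul.
Proof. by case=> f a; rewrite /wr_mul /= -shiftM !mulgV shift1 mulgV. Qed.

HB.instance Definition _ := isGroup.Build (wreath H rho)
  wr_mulA wr_mul1 wr_mulr1 wr_mulV wr_mulrV.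

Definition wr_in (f : dsum X H) : wreath H rho := Wreath f 1.

Lemma wr_in_morph : {morph wr_in : f f' / f * f'}.
Proof. by move=> f f'; congr Wreath; rewrite /= ?shift1 ?mulg1. Qed.

HB.instance Definition _ :=
  isMultiplicative.Build (dsum X H) (wreath H rho) wr_in wr_in_morph.

Definition wr_proj (w : wreath H rho) : Gamma := wr_top w.

Lemma wr_proj_morph : {morph wr_proj : v w / v * w}.
Proof. by []. Qed.

HB.instance Definition _ :=
  isMultiplicative.Build (wreath H rho) Gamma wr_proj wr_proj_morph.

End Wreath.

Arguments wr_in {Gamma} H {X} rho f.
Arguments wr_proj {Gamma} H {X} rho w.

Section QuotientAction.
Variables (Gamma Q : groupType) (sigma : {multiplicative Gamma -> Q}).

Lemma quotient_act1 x : sigma 1 * x = x.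
Proof.
have /(congr1 (fun y => (sigma 1)^-1 * y)) := gmulfM (s := sigma) 1 1.
by rewrite mulg1 mulKg mulVg => <-; rewrite mul1g.
Qed.

Lemma quotient_actM a b x : sigma (a * b) * x = sigma a * (sigma b * x).
Proof. by rewrite gmulfM mulgA. Qed.

Definition quotient_action : group_action Gamma Q :=
  @GroupAction Gamma Q (fun a q => sigma a * q) quotient_act1 quotient_actM.

End QuotientAction.

Definition surface_triple (g : nat) (Gamma Q : groupType)
    (phi : {multiplicative surface_group g -> Gamma})
    (sigma : {multiplicative Gamma -> Q}) : Prop :=
  range sigma = setT /\ is_abelian (range (sigma \o phi)).

Definition genus_rank_pairs : set (nat * nat) :=
  [set p | [/\ (0 < p.1)%N, (p.1 + 1 <= p.2)%N & (p.2 <= 2 * p.1)%N]].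

Definition C_Surf (D : set (nat * nat)) (Gamma : groupType) : Prop :=
  exists (Q : groupType) (sigma : {multiplicative Gamma -> Q}),
    range sigma = setT /\
    forall g r : nat, D (g, r) ->
      exists phi : {multiplicative surface_group g -> Gamma},
        surface_triple phi sigma /\
        int_rank (range (sigma \o phi)) = r%:E%E.

(* Main.v *)
(* An element f of the base group is a product of n mixed commutators exactly
   when it lies in a right ideal of Z[Q] generated by n differences q_i - 1; for
   Theta = <q_1, ..., q_n> this forces the coefficient sum of f over Theta (the
   [mass] below) to vanish.  For a surface triple, let s_1, ..., s_2g be the
   images in Q of the standard generators and take for x the sum of all s_k - 1.
   A subgroup Theta seeing no mass of x contains every s_k, as only the
   coefficient of 1 is negative; hence cl_{G,N}(x) is the intermediate rank of
   P = <s_1, ..., s_2g>.  A product of n ordinary commutators has zero mass for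
   the subgroup generated by its 2n entries, so r <= 2 cl_G(x).  Finally, if a, b
   in Gamma have commuting images in Q, the commutator of (-1, a) and (1, b) is
   ((a - 1) + (b - 1), [a, b]); multiplying over the g handles and using the
   surface relation gives cl_G(x) <= g. *)
Require Import Defs.
From HB Require Import structures.
From mathcomp Require Import all_boot all_order all_algebra finmap.
From mathcomp Require Import all_classical all_reals ereal.
From mathcomp Require Import zify ring.

Set Implicit Arguments.
Unset Strict Implicit.
Unset Printing Implicit Defensive.

Import Order.TTheory GRing.Theory Num.Theory.

Local Open Scope classical_set_scope.
Local Open Scope ring_scope.

(** * Attained minima and infima of natural numbers *)

Lemma nat_minP (A : set nat) :
  A !=set0 -> A (nat_min A) /\ forall m, A m -> (nat_min A <= m)%N.
Proof.
move=> [n An]; have exA : exists n, `[< A n >] by exists n; apply/asboolP.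
apply: (xgetPex 0%N (P := [set n | A n /\ forall m, A m -> (n <= m)%N])).
case: (ex_minnP exA) => k /asboolP Ak kmin.
by exists k; split=> // m Am; apply: kmin; apply/asboolP.
Qed.

Lemma enat_inf_fin (A : set (\bar nat)) (n : nat) : enat_inf A = n%:E%E ->
  A n%:E%E /\ forall m : nat, A m%:E%E -> (n <= m)%N.
Proof.
rewrite /enat_inf; case: asboolP => // -[k Ak] [<-].
by apply: (@nat_minP [set n : nat | A n%:E%E]); exists k.
Qed.

Lemma enat_inf_le (A : set (\bar nat)) (m : nat) : A m%:E%E ->
  exists2 k : nat, enat_inf A = k%:E%E & (k <= m)%N.
Proof.
move=> Am; rewrite /enat_inf; case: asboolP => [exA|[]]; last by exists m.
exists (nat_min [set n : nat | A n%:E%E]) => //.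
have [_ minA] := @nat_minP [set n : nat | A n%:E%E] exA; exact: minA.
Qed.

(** * Generated subgroups and the intermediate rank *)

Section Generation.
Variable G : groupType.
Implicit Types (S H P : set G).
Local Open Scope group_scope.

Lemma sub_gen S : S `<=` gen S. Proof. exact: sub_gen_smallest. Qed.

Lemma gen_sub S H : is_subgroup H -> S `<=` H -> gen S `<=` H.
Proof. exact: smallest_sub. Qed.

Lemma gen_subgroup S : is_subgroup (gen S).
Proof.
split=> [|x y Sx Sy|x Sx] H [] subH SH /=; have [H1 HM HV] := subH.
- by [].
- by apply: HM; [apply: Sx|apply: Sy].
- by apply: HV; apply: Sx.
Qed.

Lemma gen_prod S (I : Type) (s : seq I) (F : I -> G) :
  (forall i, S (F i)) -> gen S (\prod_(i <- s) F i).
Proof.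
have [S1 SM _] := gen_subgroup S.
by move=> SF; apply: big_ind => // i _; apply: sub_gen.
Qed.

Lemma enat_card_range n (t : 'I_n -> G) :
  exists2 m : nat, enat_card (range t) = m%:E%E & (m <= n)%N.
Proof.
have fint : finite_set (range t) by exact/finite_image/finite_finset.
rewrite /enat_card asboolT//; exists #|` fset_set (range t)|%fset => //.
rewrite fset_set_image; last exact: finite_finset.
apply: leq_trans (leq_imfset_card _ _ _) _.
rewrite -[leqRHS](size_enum_ord n) uniq_leq_size ?fset_uniq// => i _.
by rewrite mem_enum.
Qed.

(** Finite infima are attained, which yields the tuple. Conversely, the subgroup generated by an
    n-tuple, repetitions allowed, has rank at most n and competes in the infimum. *)
Lemma int_rank_fin P (r : nat) : int_rank P = r%:E%E ->
  (exists t : 'I_r -> G, P `<=` gen (range t)) /\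
  forall n (t : 'I_n -> G), P `<=` gen (range t) -> (r <= n)%N.
Proof.
move=> /enat_inf_fin[[H [subH PH] /enat_inf_fin[[S genS cardS] _]] rmin].
split.
  move: cardS; rewrite /enat_card; case: asboolP => // finS [cardS].
  (* The default [1] is never reached: the enumeration of [S] has length r. *)
  exists (fun i => nth 1 (fset_set S) i); rewrite -genS in PH.
  apply: subset_trans PH _; apply: gen_sub; first exact: gen_subgroup.
  move=> x Sx; apply: sub_gen.
  have xS : x \in fset_set S by rewrite in_fset_set// inE.
  have ltxr : (index x (fset_set S) < r)%N by rewrite -cardS index_mem.
  by exists (Ordinal ltxr) => //=; rewrite nth_index.
move=> n t Pt; have [m cardt ltmn] := enat_card_range t.
have [k rankt lekm] : exists2 k : nat, rank (gen (range t)) = k%:E%E & (k <= m)%N.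
  by apply: enat_inf_le; exists (range t).
apply: leq_trans (leq_trans lekm ltmn); apply: rmin; exists (gen (range t)) => //.
by split=> //; exact: gen_subgroup.
Qed.

End Generation.

Local Notation Zgrp := (Algebra.to_multiplicative int).

(** * Finitely supported integer functions and their mass on a subset *)

Section IntSum.
Variable X : choiceType.
Implicit Types (f g : dsum X Zgrp) (q : X).
Local Open Scope group_scope.

(** Reads a value of the multiplicatively written group [Zgrp] as an integer, so that ring
    arithmetic applies. *)
Definition dval f q : int := f q.

Lemma dval_inj f g : dval f =1 dval g -> f = g.
Proof. by move=> fg; apply: dsumP => q; exact: fg. Qed.

Lemma dval1 q : dval 1 q = 0%R.
Proof. by rewrite /dval dsum1E. Qed.

Lemma dvalM f g q : dval (f * g) q = (dval f q + dval g q)%R.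
Proof. by rewrite /dval dsumME. Qed.

Lemma dvalV f q : dval f^-1 q = (- dval f q)%R.
Proof. by rewrite /dval dsum_invE. Qed.

Lemma dval_prod (I : Type) (s : seq I) (F : I -> dsum X Zgrp) q :
  dval (\prod_(i <- s) F i) q = (\sum_(i <- s) dval (F i) q)%R.
Proof.
by apply: (big_morph (dval^~ q)) => [f g|]; [exact: dvalM|exact: dval1].
Qed.

Definition dirac q : dsum X Zgrp := [fsfun x in [fset q]%fset => (1%R : int)].

Lemma diracE q x : dval (dirac q) x = (x == q)%:R%R.
Proof. by rewrite /dval /dirac /dsum_fun fsfun_fun inE; case: eqP. Qed.

Lemma finsupp_dval f q : (q \in finsupp f) = (dval f q != 0%R).
Proof. exact: mem_finsupp. Qed.

Definition mass (Theta : set X) f : int :=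
  (\sum_(q <- finsupp f) if `[< Theta q >] then dval f q else 0)%R.

(** Allows elements with different supports to be summed over one common finite set. *)
Lemma mass_supp (Theta : set X) f (A : {fset X}) : (finsupp f `<=` A)%fset ->
  mass Theta f = (\sum_(q <- A) if `[< Theta q >] then dval f q else 0)%R.
Proof.
move=> fA; apply: big_fset_incl => // q _.
by rewrite finsupp_dval negbK => /eqP ->; rewrite if_same.
Qed.

Lemma massM Theta f g : mass Theta (f * g) = (mass Theta f + mass Theta g)%R.
Proof.
set A := (finsupp f `|` finsupp g)%fset.
rewrite (@mass_supp _ f A) ?fsubsetUl// (@mass_supp _ g A) ?fsubsetUr//.
rewrite (@mass_supp _ (f * g) A) -?big_split/=.
  by apply: eq_bigr => q _; case: ifP => _; rewrite ?dvalM ?addr0.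
apply/fsubsetP => q; rewrite in_fsetU !finsupp_dval dvalM.
by apply: contraR => /norP[/negPn/eqP-> /negPn/eqP->]; rewrite addr0.
Qed.

Lemma mass1 Theta : mass Theta 1 = 0%R.
Proof. by apply: (addrI (mass Theta 1)); rewrite -massM mulg1 addr0. Qed.

Lemma massV Theta f : mass Theta f^-1 = (- mass Theta f)%R.
Proof. by apply: (addrI (mass Theta f)); rewrite -massM mulgV mass1 subrr. Qed.

Lemma mass_prod Theta (I : Type) (s : seq I) (F : I -> dsum X Zgrp) :
  mass Theta (\prod_(i <- s) F i) = (\sum_(i <- s) mass Theta (F i))%R.
Proof. by apply: (big_morph (mass Theta)) => [f g|]; [exact: massM|exact: mass1]. Qed.

Lemma mass_dirac (Theta : set X) q : mass Theta (dirac q) = `[< Theta q >]%:R%R.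
Proof.
have sub1 : (finsupp (dirac q) `<=` [fset q])%fset.
  apply/fsubsetP => x; rewrite finsupp_dval diracE in_fset1.
  by case: (x == q); rewrite /= ?eqxx.
by rewrite (mass_supp _ sub1) big_seq_fset1 diracE eqxx; case: asboolP.
Qed.

Lemma mass_shift (Gamma : groupType) (rho : group_action Gamma X)
    (Theta : set X) (a : Gamma) f :
  (forall q, Theta (rho a q) <-> Theta q) ->
  mass Theta (shift rho a f) = mass Theta f.
Proof.
move=> Thetaa.
have rhoK q : rho a^-1 (rho a q) = q by rewrite -actM mulVg act1.
have rhoKV q : rho a (rho a^-1 q) = q by rewrite -actM mulgV act1.
rewrite (@mass_supp _ _ [fset rho a y | y in finsupp f]%fset).
  rewrite big_imfset/=; last by move=> x y _ _ /(congr1 (rho a^-1)); rewrite !rhoK.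
  apply: eq_bigr => q _; rewrite (asbool_equiv_eq (Thetaa q)).
  by rewrite /dval shiftE rhoK.
apply/fsubsetP => q; rewrite finsupp_dval /dval shiftE => fq.
by apply/imfsetP; exists (rho a^-1 q); rewrite /= ?finsupp_dval ?rhoKV.
Qed.

End IntSum.

(** * Homomorphisms, subgroups and shortest factorisations *)

Section MultiplicativeGroup.
Variables (G H : groupType) (f : {multiplicative G -> H}).
Local Open Scope group_scope.

Lemma multiplicative1 : f 1 = 1.
Proof. by apply: (mulgI (f 1)); rewrite -gmulfM !mulg1. Qed.

Lemma multiplicativeV x : f x^-1 = (f x)^-1.
Proof. by apply: (mulgI (f x)); rewrite -gmulfM !mulgV multiplicative1. Qed.

End MultiplicativeGroup.

Section Subgroup.
Variables (G : groupType) (H : set G).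
Local Open Scope group_scope.
Hypothesis subH : is_subgroup H.

Lemma subgroup_mull x y : H x -> H (x * y) <-> H y.
Proof.
have [_ HM HV] := subH; move=> Hx; split=> [Hxy|]; last exact: HM.
by rewrite -(mulKg x y); apply: HM => //; exact: HV.
Qed.

Lemma subgroup_preim (K : groupType) (f : {multiplicative K -> G}) :
  is_subgroup (f @^-1` H).
Proof.
have [H1 HM HV] := subH; split=> [|x y Hx Hy|x Hx] /=.
- by rewrite multiplicative1.
- by rewrite gmulfM; apply: HM.
- by rewrite multiplicativeV; apply: HV.
Qed.

End Subgroup.

(** One explicit factorisation rules out the default value of [nat_min], so [cl] is realised by a
    shortest factorisation. *)
Lemma cl_spec (G : groupType) (N : set G) (x : G) n (c : 'I_n -> G) :
  (forall i, mixed_commutators N (c i)) -> x = (\prod_(i < n) c i)%g ->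
  (cl N x <= n)%N /\ exists c' : 'I_(cl N x) -> G,
    (forall i, mixed_commutators N (c' i)) /\ x = (\prod_i c' i)%g.
Proof.
move=> Nc xc.
have [ex_cl min_cl] := @nat_minP [set n | exists c : 'I_n -> G,
    (forall i, mixed_commutators N (c i)) /\ x = (\prod_(i < n) c i)%g]
    (ex_intro _ n (ex_intro _ c (conj Nc xc))).
by split=> //; apply: min_cl; exists c.
Qed.

(** * Presented groups and the surface relation *)

Section Presented.
Variables (X : choiceType) (rels : set (seq (X * bool))).
Local Open Scope group_scope.
Local Notation cls := (pres_class rels).

Lemma pres_class_cat u v : cls (u ++ v) = cls u * cls v.
Proof. by rewrite -pres_mulE. Qed.

Lemma pres_class_cons x y w : cls [:: x, y & w] = cls [:: x] * cls (y :: w).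
Proof. exact: (pres_class_cat [:: x]). Qed.

Lemma pres_class_inv x : cls [:: (x, true)] = (cls [:: (x, false)])^-1.
Proof. by apply: esym; exact: pres_invE. Qed.

Lemma pres_class_flatten (I : Type) (s : seq I) (F : I -> seq (X * bool)) :
  cls (flatten [seq F i | i <- s]) = \prod_(i <- s) cls (F i).
Proof.
by elim: s => [|i s IHs]; rewrite ?big_nil// big_cons /= pres_class_cat IHs.
Qed.

Lemma pres_ind (H : set (presented rels)) : is_subgroup H ->
  (forall x, H (cls [:: (x, false)])) -> forall y, H y.
Proof.
move=> [H1 HM HV] Hgen y; rewrite -(pres_repr y).
elim: (repr y) => [//|[x b] w IHw]; rewrite -cat1s pres_class_cat.
by apply: HM => //; case: b => //; rewrite pres_class_inv; apply: HV.
Qed.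

End Presented.

Section SurfaceGroup.
Variable g : nat.
Local Open Scope group_scope.

Definition surface_gen (b : bool) (i : 'I_g) : surface_group g :=
  pres_class [set surface_relator g] [:: (i, b, false)].

Lemma surface_relation :
  \prod_(i < g) (surface_gen false i * surface_gen true i
    * (surface_gen false i)^-1 * (surface_gen true i)^-1) = 1.
Proof.
transitivity (pres_class [set surface_relator g] (surface_relator g)); last first.
  by apply/pres_classP; exact: WRel.
rewrite pres_class_flatten [index_enum _]unlock enumT; apply: eq_bigr => i _.
by rewrite /surface_gen -!pres_class_inv !pres_class_cons !mulgA.
Qed.

Lemma surface_ind (H : set (surface_group g)) : is_subgroup H ->
  (forall b i, H (surface_gen b i)) -> forall y, H y.
Proof. by move=> subH Hgen; apply: pres_ind => // -[i b]; exact: Hgen. Qed.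

End SurfaceGroup.

(** * The wreath product over left translation on Q *)

Section RegularWreath.
Variables (Gamma Q : groupType) (sigma : {multiplicative Gamma -> Q}).
Local Open Scope group_scope.
Local Notation rho := (quotient_action sigma).
Local Notation base := (dsum Q Zgrp).
Local Notation G := (wreath Zgrp rho).
Local Notation N := (range (wr_in Zgrp rho)).
Implicit Types (f h : base) (w v : G) (Theta : set Q).

Lemma dval_shift a f q : dval (shift rho a f) q = dval f ((sigma a)^-1 * q).
Proof. by rewrite /dval shiftE /= multiplicativeV. Qed.

Lemma eq_shift a b f : sigma a = sigma b -> shift rho a f = shift rho b f.
Proof. by move=> ab; apply: dval_inj => q; rewrite !dval_shift ab. Qed.

Lemma shift_dirac a q : shift rho a (dirac q) = dirac (sigma a * q).
Proof.
apply: dval_inj => x; rewrite dval_shift !diracE.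
by congr (nat_of_bool _)%:R; rewrite -(inj_eq (mulgI (sigma a))) mulVKg.
Qed.

(** Tops in the kernel of [sigma] shift trivially, so no twisting occurs. *)
Lemma prod_wreath (I : Type) (s : seq I) (F : I -> base) (c : I -> Gamma) :
  (forall i, sigma (c i) = 1) ->
  \prod_(i <- s) (Wreath (F i) (c i) : G) =
  Wreath (\prod_(i <- s) F i) (\prod_(i <- s) c i).
Proof.
move=> c1; elim: s => [|i s IHs]; first by rewrite !big_nil.
rewrite !big_cons IHs; congr Wreath => /=.
by rewrite (@eq_shift _ 1) ?shift1// c1 multiplicative1.
Qed.

Section Mass.
Variable Theta : set Q.
Hypothesis subTheta : is_subgroup Theta.

(** Left multiplication by an element of [Theta] preserves [Theta], so the shift keeps the mass: on
    the preimage of [Theta], mass is a homomorphism to the integers. *)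
Lemma mass_wrM w v : Theta (sigma (wr_top w)) ->
  mass Theta (wr_base (w * v)) = (mass Theta (wr_base w) + mass Theta (wr_base v))%R.
Proof.
move=> Thetaw; rewrite massM mass_shift// => q.
exact: (subgroup_mull subTheta).
Qed.

Lemma mass_wrV w : Theta (sigma (wr_top w)) ->
  mass Theta (wr_base w^-1) = (- mass Theta (wr_base w))%R.
Proof.
move=> Thetaw; apply: (addrI (mass Theta (wr_base w))).
by rewrite -mass_wrM// mulgV subrr mass1.
Qed.

(** A homomorphism to an abelian group kills commutators. The predicate [K] also carries membership
    in the preimage of [Theta], the only place where mass is multiplicative. *)
Lemma mass_prod_comm (I : Type) (s : seq I) (w v : I -> G) :
  (forall i, Theta (sigma (wr_top (w i)))) ->
  (forall i, Theta (sigma (wr_top (v i)))) ->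
  mass Theta (wr_base (\prod_(i <- s) (w i * v i * (w i)^-1 * (v i)^-1))) = 0%R.
Proof.
move=> Thetaw Thetav.
have [T1 TM TV] := subgroup_preim (subgroup_preim subTheta sigma) (wr_proj Zgrp rho).
pose K (x : G) := Theta (sigma (wr_top x)) /\ mass Theta (wr_base x) = 0%R.
suff [] : K (\prod_(i <- s) (w i * v i * (w i)^-1 * (v i)^-1)) by [].
apply: big_ind => [|x y [Tx x0] [Ty y0]|i _].
- by split; [exact: T1|rewrite mass1].
- by split; [exact: TM|rewrite mass_wrM// x0 y0 addr0].
- have Tw := Thetaw i; have Tv := Thetav i.
  have TwV : Theta (sigma (wr_top (w i)^-1)) by exact: TV.
  have TvV : Theta (sigma (wr_top (v i)^-1)) by exact: TV.
  have Twv : Theta (sigma (wr_top (w i * v i))) by exact: TM.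
  have Twvw : Theta (sigma (wr_top (w i * v i * (w i)^-1))) by exact: TM.
  split; first exact: TM.
  by rewrite !mass_wrM// !mass_wrV//; ring.
Qed.

End Mass.

(* The element q - 1 of the augmentation ideal of Z[Q]. *)
Definition augm q : base := dirac q * (dirac 1)^-1.

Lemma mass_augm Theta q : Theta 1 ->
  mass Theta (augm q) = (- (~~ `[< Theta q >])%:R)%R.
Proof.
move=> Theta1; rewrite massM massV !mass_dirac (asboolT Theta1).
by case: (`[< Theta q >]) => /=; ring.
Qed.

(** Since a b a^-1 acts as b and the whole commutator acts trivially, the four base terms are -1, a,
    b and -1. *)
Lemma comm_augm a b : sigma a * sigma b = sigma b * sigma a ->
  let w : G := Wreath (dirac 1)^-1 a in let v : G := Wreath (dirac 1) b in
  w * v * w^-1 * v^-1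
  = Wreath (augm (sigma a) * augm (sigma b)) (a * b * a^-1 * b^-1).
Proof.
move=> ab; congr Wreath => /=.
have aba : sigma (a * b * a^-1) = sigma b by rewrite !gmulfM multiplicativeV ab mulgK.
rewrite -!shiftM (eq_shift _ aba).
have -> : shift rho (a * b * a^-1 * b^-1) (dirac 1)^-1 = (dirac 1)^-1.
  rewrite (@eq_shift _ 1) ?shift1//.
  by rewrite gmulfM aba multiplicativeV mulgV multiplicative1.
rewrite invgK !shift_dirac !mulg1.
by apply: dval_inj => q; rewrite /augm !dvalM; ring.
Qed.

(** * Sums of differences as products of mixed commutators *)

Section SumOfDifferences.
Variables (n : nat) (c : 'I_n -> Gamma).

(* Membership in the right ideal of Z[Q] generated by the [sigma (c i) - 1]. *)
Definition diff_sum f : Prop :=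
  exists h : 'I_n -> base, f = \prod_(i < n) (shift rho (c i) (h i) * (h i)^-1).

Lemma dval_diff (h : 'I_n -> base) q :
  dval (\prod_(i < n) (shift rho (c i) (h i) * (h i)^-1)) q =
  (\sum_(i < n) (dval (h i) ((sigma (c i))^-1 * q)%g - dval (h i) q))%R.
Proof.
by rewrite dval_prod; apply: eq_bigr => i _; rewrite dvalM dvalV dval_shift.
Qed.

Lemma diff_sum_subgroup : is_subgroup diff_sum.
Proof.
split=> [|_ _ [h ->] [h' ->]|_ [h ->]].
- exists (fun=> 1); rewrite big1// => i _.
  by rewrite shift_one mulgV.
- exists (fun i => h i * h' i); apply: dval_inj => q.
  rewrite dvalM !dval_diff -big_split/=.
  by apply: eq_bigr => i _; rewrite !dvalM; ring.
- exists (fun i => (h i)^-1); apply: dval_inj => q.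
  rewrite dvalV !dval_diff -sumrN.
  by apply: eq_bigr => i _; rewrite !dvalV; ring.
Qed.

(** Written additively, the elements q with q f - f in the ideal for every f form a subgroup: x y f
    - f = (x (y f) - y f) + (y f - f), and x^-1 f - f = -(x h - h) with h = x^-1 f. Quantifying over
    all f and all lifts of q is what makes [K] closed. *)
Lemma diff_sum_gen a f : range sigma = setT ->
  gen (range (sigma \o c)) (sigma a) -> diff_sum (shift rho a f * f^-1).
Proof.
move=> sigmaT; have [J1 JM JV] := diff_sum_subgroup.
pose K := [set q : Q | forall b f, sigma b = q -> diff_sum (shift rho b f * f^-1)].
have lift q : exists b, sigma b = q.
  by have [b _ <-] : range sigma q by [rewrite sigmaT]; exists b.
suff sK : gen (range (sigma \o c)) `<=` K by move=> /sK; apply.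
apply: gen_sub => [|_ [i _ <-] b h /= bi]; last first.
  exists (fun j => if j == i then h else 1); apply: dval_inj => q.
  rewrite dval_diff (bigD1 i)//= eqxx big1 => [|j /negPf ->].
    by rewrite dvalM dvalV dval_shift bi addr0.
  by rewrite !dval1 subrr.
split=> [b h b1|x y Kx Ky b h bxy|x Kx b h bx].
- by rewrite (@eq_shift _ 1) ?shift1 ?mulgV// b1 multiplicative1.
- have [[b1 b1x] [b2 b2y]] := (lift x, lift y).
  have -> : shift rho b h = shift rho b1 (shift rho b2 h).
    by rewrite -shiftM; apply: eq_shift; rewrite gmulfM b1x b2y.
  rewrite -(mulgVK (shift rho b2 h) (shift rho b1 _)) -mulgA.
  by apply: JM; [exact: Kx|exact: Ky].
- have /JV : diff_sum (shift rho b^-1 (shift rho b h) * (shift rho b h)^-1).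
    by apply: Kx; rewrite multiplicativeV bx invgK.
  by rewrite -shiftM mulVg shift1 invgM invgK.
Qed.

(** Each difference is the commutator of the pure top element [c i] with the base element [h i]. *)
Lemma diff_sum_comm f : diff_sum f -> exists w : 'I_n -> G,
  (forall i, mixed_commutators N (w i)) /\ wr_in Zgrp rho f = \prod_i w i.
Proof.
move=> [h ->]; exists (fun i => wr_in Zgrp rho (shift rho (c i) (h i) * (h i)^-1)).
split=> [i|]; last by apply: (big_morph (wr_in Zgrp rho)) => // f1 f2; rewrite gmulfM.
exists (Wreath 1 (c i)), (wr_in Zgrp rho (h i)); split; first by exists (h i).
congr Wreath => /=; last by rewrite mulg1 mulgV mul1g invg1.
by rewrite -!shiftM mul1g !mulg1 mulgV !invg1 !mulg1 !shift1 mulg1.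
Qed.

End SumOfDifferences.

Hypothesis sigma_surj : range sigma = setT.

(** * The witness of a surface triple and its two lengths *)

Section SurfaceTriple.
Variables (g r : nat) (phi : {multiplicative surface_group g -> Gamma}).
Local Notation P := (range (sigma \o phi)).
Hypotheses (abP : is_abelian P) (rP : int_rank P = r%:E%E).
Local Notation s b i := (sigma (phi (surface_gen b i))).

Let witness : base := \prod_(i < g) (augm (s false i) * augm (s true i)).

(* The sum of the (nonpositive) integers [mass Theta (augm _)] can only vanish
   if each of them does, so a subgroup seeing no mass contains all generators of [P]. *)
Let mass_witness Theta : is_subgroup Theta -> mass Theta witness = 0%R ->
  P `<=` Theta.
Proof.
move=> subTheta; have [Theta1 _ _] := subTheta; rewrite mass_prod.
have mE i : mass Theta (augm (s false i) * augm (s true i)) =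
    (- (~~ `[< Theta (s false i) >] + ~~ `[< Theta (s true i) >])%:R)%R.
  by rewrite massM !mass_augm// natrD opprD.
rewrite (eq_bigr _ (fun i _ => mE i)) sumrN => /eqP.
rewrite oppr_eq0 -natr_sum pnatr_eq0 sum_nat_eq0 => /forallP Theta_s _ [y _ <-].
apply: (surface_ind (subgroup_preim (subgroup_preim subTheta sigma) phi)) => b i.
move: (Theta_s i) => /=; rewrite addn_eq0 !eqb0 !negbK => /andP[/asboolP ? /asboolP ?].
by case: b.
Qed.

Let witness_mixed : exists w : 'I_r -> G,
  (forall i, mixed_commutators N (w i)) /\ wr_in Zgrp rho witness = \prod_i w i.
Proof.
have [[t Pt] _] := int_rank_fin rP.
(* Lifts to [Gamma] of r elements generating a subgroup that contains [P]; they become the tops of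
   the r commutators. *)
have /choice[c ct] i : exists a, sigma a = t i.
  by have [a _ <-] : range sigma (t i) by [rewrite sigma_surj]; exists a.
apply: (diff_sum_comm (c := c)); have [J1 JM JV] := diff_sum_subgroup c.
have J b i : diff_sum c (augm (s b i)).
  rewrite /augm -(mulg1 (s b i)) -shift_dirac; apply: diff_sum_gen => //.
  by rewrite (_ : _ \o _ = t) ?funeqE//; apply: Pt; exists (surface_gen b i).
by apply: big_ind => // i _; apply: JM.
Qed.

Let witness_comm : exists w : 'I_g -> G,
  (forall i, mixed_commutators setT (w i)) /\ wr_in Zgrp rho witness = \prod_i w i.
Proof.
pose a b i := phi (surface_gen b i).
have ab i : sigma (a false i) * sigma (a true i) = sigma (a true i) * sigma (a false i).
  by apply: abP; [exists (surface_gen false i)|exists (surface_gen true i)].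
pose x i : G := Wreath (dirac 1)^-1 (a false i).
pose y i : G := Wreath (dirac 1) (a true i).
exists (fun i => x i * y i * (x i)^-1 * (y i)^-1); split=> [i|].
  by exists (x i), (y i).
under eq_bigr do rewrite comm_augm//.
rewrite prod_wreath => [|i]; last first.
  by rewrite !gmulfM !multiplicativeV ab mulgK mulgV.
(* The bases agree by definition; the top is the image under [phi] of the surface relator, hence
   trivial. *)
congr Wreath; transitivity (phi 1); first by rewrite multiplicative1.
rewrite -surface_relation (big_morph phi (gmulfM (s := phi)) (multiplicative1 phi)).
by apply: eq_bigr => i _; rewrite !gmulfM !multiplicativeV.
Qed.

(** Common source of both lower bounds: the subgroup generated by [t] sees no mass of the witness,
    so it contains [P]. For ordinary commutators [t] lists all 2n entries, for mixed ones only the n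
    entries x. *)
Let witness_rank m (t : 'I_m -> Q) n (x y : 'I_n -> G) :
  (forall i, gen (range t) (sigma (wr_top (x i)))) ->
  (forall i, gen (range t) (sigma (wr_top (y i)))) ->
  wr_in Zgrp rho witness = \prod_i (x i * y i * (x i)^-1 * (y i)^-1) ->
  (r <= m)%N.
Proof.
have [_ rmin] := int_rank_fin rP; have subt := gen_subgroup (range t).
move=> tx ty witnessE; apply: (rmin _ t); apply: mass_witness => //.
rewrite -[witness]/(wr_base (wr_in Zgrp rho witness)) witnessE.
exact: mass_prod_comm.
Qed.

Lemma surface_triple_lengths : exists x : G,
  [/\ comm_subgroup N x, (uphalf r <= cl [set: G] x <= g)%N & cl N x = r].
Proof.
exists (wr_in Zgrp rho witness).
have [w [Nw witness_w]] := witness_mixed.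
have [v [Gv witness_v]] := witness_comm.
have [le_r [w' [/choice[x] /choice[y xy] witness_w']]] := cl_spec Nw witness_w.
have [le_g [v' [/choice[x'] /choice[y' xy'] witness_v']]] := cl_spec Gv witness_v.
split; first by rewrite witness_w; apply: gen_prod.
  rewrite le_g andbT; move: (cl _ _) => m in v' x' y' xy' witness_v' *.
  pose t (k : 'I_(m + m)) : Q :=
    sigma (wr_top (match fintype.split k with inl i => x' i | inr i => y' i end)).
  (* The tuple [t] lists the images of both entries of each of the m commutators. *)
  suff : (r <= m + m)%N by lia.
  have tl i : t (lshift m i) = sigma (wr_top (x' i)).
    by rewrite /t -[lshift m i]/(unsplit (inl i)) unsplitK.
  have tr i : t (rshift m i) = sigma (wr_top (y' i)).
    by rewrite /t -[rshift m i]/(unsplit (inr i)) unsplitK.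
  apply: (witness_rank (t := t) (x := x') (y := y')) => [i|i|].
  - by apply: sub_gen; exists (lshift m i).
  - by apply: sub_gen; exists (rshift m i).
  - by rewrite witness_v'; apply: eq_bigr => i _; rewrite (xy' i).2.
apply/eqP; rewrite eqn_leq le_r/=.
apply: (witness_rank (t := fun i => sigma (wr_top (x i))) (x := x) (y := y)) => [i|i|].
- by apply: sub_gen; exists i.
(* The second entries lie in N, so their images in Q are trivial and add no generators. *)
- have [[f _ <-] _] := xy i; rewrite /= multiplicative1.
  by have [] := gen_subgroup (range (fun i => sigma (wr_top (x i)))).
- by apply: (etrans witness_w'); apply: eq_bigr => i _; rewrite (xy i).2.
Qed.

End SurfaceTriple.

End RegularWreath.

(** * The split exact sequence of a wreath product *)

Section Splitting.
Variables (Gamma H : groupType) (X : choiceType) (rho : group_action Gamma X).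
Local Open Scope group_scope.

Definition wr_section (a : Gamma) : wreath H rho := Wreath 1 a.

Lemma wr_section_morph : {morph wr_section : a b / a * b}.
Proof. by move=> a b; congr Wreath; rewrite /= shift_one mulg1. Qed.

HB.instance Definition _ :=
  isMultiplicative.Build Gamma (wreath H rho) wr_section wr_section_morph.

Lemma wreath_split_exact : split_exact (wr_in H rho) (wr_proj H rho).
Proof.
split.
- by move=> f f' [].
- by apply/seteqP; split=> [_ [f _ <-]//|[f a] /= a1]; exists f => //; congr Wreath.
- by apply/seteqP; split=> // a _; exists (Wreath 1 a).
- by exists wr_section.
Qed.

End Splitting.

(** * From single pairs (g, r) to the whole set D *)

Theorem theorem1p9 (R : realType) (D : set (nat * nat)) (Gamma : groupType)
    (D_nonempty : D !=set0) (D_pairs : D `<=` genus_rank_pairs)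
    (Gamma_in_C : C_Surf D Gamma) :
  exists (Q : groupType) (sigma : {multiplicative Gamma -> Q}),
    range sigma = setT /\
    let Z : groupType := Algebra.to_multiplicative int in
    let rho : group_action Gamma Q := quotient_action sigma in
    let G : groupType := wreath Z rho in
    let N : set G := range (wr_in Z rho) in
    [/\ forall g r : nat, D (g, r) ->
          exists x : G,
            [/\ comm_subgroup N x,
                (uphalf r <= cl [set: G] x <= g)%N
              & cl N x = r],
        ~ (forall x : G, comm_subgroup N x -> cl [set: G] x = cl N x),
        split_exact (wr_in Z rho) (wr_proj Z rho)
      & forall C : R, 1 <= C < 2 ->
          ereal_sup [set (p.2%:R - C * p.1%:R)%:E | p in D] = +oo%E ->
          ereal_sup [set ((cl N x)%:R - C * (cl [set: G] x)%:R)%:E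
                    | x in comm_subgroup N] = +oo%E ].
Proof.
have [Q [sigma [sigma_surj triples]]] := Gamma_in_C.
exists Q, sigma; split=> // Z rho G N.
have lengths g r : D (g, r) -> exists x : G,
    [/\ comm_subgroup N x, (uphalf r <= cl [set: G] x <= g)%N & cl N x = r].
  move=> /triples[phi [[_ abP] rP]].
  exact: (surface_triple_lengths sigma_surj abP rP).
split=> //.
- move=> cl_eq; have [[g r] Dgr] := D_nonempty.
  have [x [Nx /andP[_ le_g] eq_r]] := lengths _ _ Dgr.
  have [/= _ lt_gr _] := D_pairs _ Dgr.
  (* Equality of the lengths would give r <= g, against g + 1 <= r. *)
  by move: le_g; rewrite (cl_eq x Nx) eq_r; lia.
- exact: wreath_split_exact.
- move=> C /andP[C1 _] supD; apply/eqP; rewrite -leye_eq -supD.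
  apply: ge_ereal_sup => _ [[g r] Dgr <-] /=.
  have [x [Nx /andP[_ le_g] eq_r]] := lengths _ _ Dgr.
  (* Each r - C g is bounded by the value at its witness, because C >= 0 and the ordinary length is
     at most g. *)
  apply: (@le_trans _ _ ((cl N x)%:R - C * (cl [set: G] x)%:R)%:E).
    rewrite lee_fin eq_r lerD2l lerN2 ler_wpM2l ?ler_nat//.
    exact: le_trans ler01 C1.
  by apply: ereal_sup_ubound; exists x.
Qed.
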